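(* Let $d\ge 1$ be a fixed integer. For each integer $k\ge1$ let $\Gamma=\widehat{\mathbb{Z}_2^{kd}}$ and let $H_K$ be the reproducing kernel Hilbert space of functions on $\Gamma$ with kernel $$K(a,b)=\sum_{l=(k_1,\dots,k_d)\in\mathbb{N}^d,\ |l|=k}\frac{1}{d^k}\binom{k}{l}\prod_{j=1}^d\prod_{i=1}^{k_j}\chi\big(a^j_i=b^j_i\big),\qquad a,b\in\Gamma.$$ Then, as $k\to\infty$, $$\dim(H_K)\sim\frac{2^{k-d+1}k^{d-1}}{(d-1)!},\qquad\text{hence}\qquad \frac{\dim(H_K)}{2^{kd}}\sim\frac{k^{d-1}}{2^{d-1}(d-1)!\,2^{k(d-1)}}.$$
   Context: $\mathbb{N}$ includes $0$; $|l|=k_1+\dots+k_d$; $\binom{k}{l}=\frac{k!}{k_1!\cdots k_d!}$; $\chi(P)=1$ if $P$ holds and $0$ otherwise. The dual group $\Gamma$ of $\mathbb{Z}_2^{kd}$ is identified with $\mathbb{Z}_2^{kd}$, whose elements are $k\times d$ binary matrices $a=(a_i^j)_{1\le i\le k,\,1\le j\le d}$. $H_K=\mathrm{span}\{K_b:\ b\in\Gamma\}$, where $K_b(a)=K(a,b)$, is the Hilbert space of functions $\Gamma\to\mathbb{C}$ having $K$ as reproducing kernel, and $\dim$ is its complex dimension. $u_k\sim v_k$ means $u_k/v_k\to1$. *)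

(* Defs.v *)
From mathcomp Require Import all_boot all_order all_algebra.
From mathcomp Require Import complex.
From mathcomp Require Import all_classical all_reals all_analysis.

Set Implicit Arguments.
Unset Strict Implicit.
Unset Printing Implicit Defensive.

Import Order.TTheory GRing.Theory Num.Theory.
Import numFieldNormedType.Exports.

Local Open Scope classical_set_scope.
Local Open Scope ring_scope.

(** The dual group of Z_2^(kd), identified with Z_2^(kd): the entry [a i j]
    of the k x d binary matrix [a] is a^(j+1)_(i+1). *)
Definition dualZ2 (k d : nat) : finType := 'M['Z_2]_(k, d).

(** [l] ranges over the vectors (k_1, ..., k_d) of N^d with |l| = k; bounding
    the entries by k loses nothing, since every k_j is at most |l|. *)
Definition kernelK (C : fieldType) (k d : nat) (a b : dualZ2 k d) : C :=
  \sum_(l : {ffun 'I_d -> 'I_k.+1} | (\sum_(j < d) l j == k)%N)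
    (d ^ k)%:R^-1 * (k`!%:R / (\prod_(j < d) (l j)`!)%N%:R)
    * \prod_(j < d) \prod_(i < k | (i < l j)%N) (a i j == b i j)%:R.

Definition kernelK_at (C : fieldType) (k d : nat) (b : dualZ2 k d) :
    {ffun dualZ2 k d -> C^o} :=
  [ffun a => kernelK C a b].

(** Gamma is finite, so the span of the kernel functions K_b is already complete
    and is, as a vector space, the reproducing kernel Hilbert space of K. *)
Definition HK (C : fieldType) (k d : nat) : {vspace {ffun dualZ2 k d -> C^o}} :=
  <<[seq kernelK_at C b | b : dualZ2 k d]>>%VS.

Definition asymp_equiv (R : realType) (u v : nat -> R) : Prop :=
  (fun k => u k / v k) @ \oo --> (1 : R).

(* Main.v *)
Require Import Defs.
From mathcomp Require Import all_boot all_order all_algebra.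
From mathcomp Require Import complex.
From mathcomp Require Import all_classical all_reals all_analysis.
From mathcomp Require Import zify ring.
Set Implicit Arguments.
Unset Strict Implicit.
Unset Printing Implicit Defensive.
Import Order.TTheory GRing.Theory Num.Theory.
Import numFieldNormedType.Exports.
Local Open Scope ring_scope.

(** The kernel depends only on [a - b], so it is diagonalised by the characters
    of Z_2^(kd) (the Walsh functions), and the dimension of its span is the
    number of characters with a nonzero eigenvalue. Writing the indicator
    [a = b] of one entry as the average of the two characters of Z_2, the term
    of [K] indexed by [l] becomes a combination, with positive coefficients, of
    exactly the characters [x] whose support lies in the cells (i, j) with
    [i < l j]. The multinomial weights are positive, so nothing cancels when the
    terms are added, and [x] survives iff some [l] with |l| = k dominates the
    column heights of [x], the height of a column being one plus the position of
    its last nonzero entry. Slack can always be added to one coordinate of [l],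
    so the condition says that the heights of the columns of [x] sum to at most
    [k] ([kernel_eigenvalue_neq0]).

    It remains to count these matrices. There are 1, 1, 2, 4, ... columns of
    height 0, 1, 2, 3, ..., so peeling off one column gives a recursion
    ([count_le_recl]); Pascal's rule and the hockey-stick identity turn it into
    the closed form, with [d] in place of [d - 1],
      sum over i <= d of C(d, i) C(k, i) 2^(k - i)   ([count_leE]).
    As C(k, i) is equivalent to k^i / i!, only the term i = d matters
    when k tends to infinity, and it is equivalent to 2^(k - d) k^d / d!. Both
    equivalences of the theorem assert that one and the same quotient tends
    to 1. *)

(** * Harmonic analysis on binary matrices *)

(** This is what makes sums over matrices of entrywise products computable
    one entry at a time; the operations are abstract because it is used both
    for characters in a field and for counting in [nat]. *)
Lemma bigA_distr_matrix (R : Type) (zero one : R) (times : Monoid.mul_law zero)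
    (plus : Monoid.add_law zero times) (J : finType) (n d : nat)
    (F : 'I_n * 'I_d -> J -> R) :
  \big[times/one]_p \big[plus/zero]_e F p e =
  \big[plus/zero]_(x : 'M[J]_(n, d)) \big[times/one]_p F p (x p.1 p.2).
Proof.
rewrite bigA_distr_bigA /=.
rewrite (reindex (fun x : 'M[J]_(n, d) => [ffun p => x p.1 p.2])) /=.
  by apply: eq_bigr => x _; apply: eq_bigr => p _; rewrite ffunE.
exists (fun f : {ffun 'I_n * 'I_d -> J} => \matrix_(i, j) f (i, j)) => [x _|f _].
  by apply/matrixP => i j; rewrite !mxE ffunE.
by apply/ffunP => -[i j]; rewrite ffunE mxE.
Qed.

Lemma big_Z2 (R : Type) (idx : R) (op : Monoid.law idx) (F : 'Z_2 -> R) :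
  \big[op/idx]_e F e = op (F 0) (F 1).
Proof.
rewrite big_ord_recl big_ord1.
by congr (op (F _) (F _)); apply: val_inj.
Qed.

Lemma Z2P (P : 'Z_2 -> Prop) : P 0 -> P 1 -> forall e, P e.
Proof.
move=> P0 P1 [[|[|//]] he].
  by have -> : Ordinal he = 0 :> 'Z_2 by apply: val_inj.
by have -> : Ordinal he = 1 :> 'Z_2 by apply: val_inj.
Qed.

Section Spectrum.
Variables (C : numFieldType) (n d : nat).
Implicit Types (a b x y : dualZ2 n d) (l : {ffun 'I_d -> 'I_n.+1}).

(** The character of Z_2^(nd) attached to the matrix [x]; binary entries are
    multiplied as natural numbers, only the parity of the exponent matters. *)
Definition walsh x : {ffun dualZ2 n d -> C^o} :=
  [ffun a : dualZ2 n d => \prod_(p : 'I_n * 'I_d) (-1) ^+ (x p.1 p.2 * a p.1 p.2)].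

Lemma walsh_orthogonal x y :
  \sum_a walsh x a * walsh y a = (2 ^ (n * d) * (x == y))%:R :> C.
Proof.
transitivity (\prod_(p : 'I_n * 'I_d) (2 * (x p.1 p.2 == y p.1 p.2)%:R : C)).
  (* Orthogonality of the two characters of Z_2, in a single cell. *)
  have E (p : 'I_n * 'I_d) : 2 * (x p.1 p.2 == y p.1 p.2)%:R =
      \sum_(e : 'Z_2) (-1) ^+ (x p.1 p.2 * e) * (-1) ^+ (y p.1 p.2 * e) :> C.
    rewrite big_Z2; move: (x _ _) (y _ _).
    by apply: Z2P; apply: Z2P; rewrite /=; ring.
  rewrite (eq_bigr _ (fun p _ => E p)) bigA_distr_matrix.
  by apply: eq_bigr => a _; rewrite !ffunE -big_split.
rewrite big_split /= prodr_const card_prod !card_ord natrM natrX; congr (_ * _).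
case: eqVneq => [->|xy]; first by rewrite big1 // => p _; rewrite eqxx.
have [/forallP xyE|] := boolP [forall p : 'I_n * 'I_d, x p.1 p.2 == y p.1 p.2].
  by case/eqP: xy; apply/matrixP => i j; apply/eqP/(xyE (i, j)).
by rewrite negb_forall => /existsP[p /negPf pF]; rewrite (bigD1 p) //= pF mul0r.
Qed.

(** Pairing a vanishing combination with [walsh y] isolates the coefficient
    of [walsh y], by orthogonality. *)
Lemma walsh_free (s : seq (dualZ2 n d)) : uniq s -> free (map walsh s).
Proof.
move=> us; apply/(@freeP _ _ _ (map_tuple walsh (in_tuple s))) => c c0 i.
pose y := s`_i.
have lts (j : 'I_(size s)) : (j < size s)%N by [].
have /eqP : \sum_a (\sum_(j < size s) c j *: (map_tuple walsh (in_tuple s))`_j) a * walsh y a = 0.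
  by rewrite c0 big1 // => a _; rewrite ffunE mul0r.
under eq_bigr do rewrite sum_ffunE mulr_suml.
rewrite exchange_big /= (bigD1 i) //= [X in _ + X]big1 => [|j ji].
  under eq_bigr do rewrite ffunE (nth_map 0) // -/y -mulrA.
  rewrite -mulr_sumr walsh_orthogonal eqxx muln1 addr0 mulf_eq0 => /orP[/eqP//|].
  by rewrite pnatr_eq0 expn_eq0.
under eq_bigr do rewrite ffunE (nth_map 0) // -mulrA.
by rewrite -mulr_sumr walsh_orthogonal /y nth_uniq // [(_ == _)%N](negPf ji) muln0 mulr0.
Qed.

Definition multinomial_weight l : C :=
  (d ^ n)%:R^-1 * (n`!%:R / (\prod_(j < d) (l j)`!)%N%:R).

(** The coefficient of [walsh x] in the expansion of the kernel; the eigenvalue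
    of the convolution operator is this number times the order 2^(nd) of the
    group. A cell below [l] contributes the average of both characters of Z_2, a
    cell above it only the trivial character. *)
Definition kernel_eigenvalue x : C :=
  \sum_(l : {ffun 'I_d -> 'I_n.+1} | (\sum_(j < d) l j == n)%N)
    multinomial_weight l *
    \prod_(p : 'I_n * 'I_d)
      (if (p.1 < l p.2)%N then 2^-1 else (x p.1 p.2 == 0)%:R).

(** For entries in Z_2 the indicator of [a = b] is the average over the two
    characters [e] of [e(a) e(b)], and the constant 1 is the trivial character;
    the product over the cells is then expanded. *)
Lemma kernelK_diagonal a b :
  kernelK C a b = \sum_x kernel_eigenvalue x * (walsh x a * walsh x b).
Proof.
under [RHS]eq_bigr do rewrite mulr_suml.
rewrite exchange_big; apply: eq_bigr => l _; rewrite -/(multinomial_weight l).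
under [RHS]eq_bigr do rewrite -mulrA.
rewrite -mulr_sumr; congr (_ * _).
transitivity (\prod_(p : 'I_n * 'I_d)
   (if (p.1 < l p.2)%N then (a p.1 p.2 == b p.1 p.2)%:R else 1 : C)).
  rewrite -(pair_bigA _ (fun (i : 'I_n) (j : 'I_d) =>
    if (i < l j)%N then (a i j == b i j)%:R else 1 : C)) /=.
  by rewrite exchange_big; apply: eq_bigr => j _; rewrite big_mkcond.
have E (p : 'I_n * 'I_d) :
    (if (p.1 < l p.2)%N then (a p.1 p.2 == b p.1 p.2)%:R else 1) =
    \sum_(e : 'Z_2) (if (p.1 < l p.2)%N then 2^-1 else (e == 0)%:R) *
      ((-1) ^+ (e * a p.1 p.2) * (-1) ^+ (e * b p.1 p.2)) :> C.
  rewrite big_Z2; move: (a _ _) (b _ _).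
  by case: ifP => _; apply: Z2P; apply: Z2P; rewrite /= ?expr0 ?expr1; field.
rewrite (eq_bigr _ (fun p _ => E p)) bigA_distr_matrix.
by apply: eq_bigr => x _; rewrite !ffunE -!big_split.
Qed.

(** Each [K_b] is a combination of these characters by [kernelK_diagonal];
    conversely the Fourier inversion formula recovers a character with a nonzero
    coefficient from the functions [K_b]. *)
Lemma HK_spectral :
  HK C n d = <<map walsh [seq x <- enum (dualZ2 n d) | kernel_eigenvalue x != 0%R]>>%VS.
Proof.
have memw x : kernel_eigenvalue x != 0 ->
    walsh x \in <<map walsh [seq x <- enum (dualZ2 n d) | kernel_eigenvalue x != 0%R]>>%VS.
  by move=> x0; apply/memv_span/map_f; rewrite mem_filter x0 mem_enum.
apply/eqP; rewrite eqEsubv; apply/andP; split; apply/span_subvP => f /mapP[].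
  move=> b _ ->.
  have -> : kernelK_at C b = \sum_x (kernel_eigenvalue x * walsh x b) *: walsh x.
    apply/ffunP => a; rewrite ffunE kernelK_diagonal sum_ffunE.
    apply: eq_bigr => x _; rewrite [RHS]ffunE.
    by rewrite -[RHS]/(kernel_eigenvalue x * walsh x b * walsh x a) mulrA mulrAC.
  apply: memv_suml => x _; have [->|x0] := eqVneq (kernel_eigenvalue x) 0.
    by rewrite mul0r scale0r mem0v.
  exact/memvZ/memw.
move=> x; rewrite mem_filter => /andP[x0 _] ->.
have -> : walsh x = ((2 ^ (n * d))%:R * kernel_eigenvalue x)^-1 *:
    \sum_b walsh x b *: kernelK_at C b.
  apply/ffunP => a; rewrite [RHS]ffunE sum_ffunE.
  have -> : \sum_b (walsh x b *: kernelK_at C b) a =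
      \sum_b \sum_y (kernel_eigenvalue y * walsh y a) * (walsh x b * walsh y b).
    apply: eq_bigr => b _; rewrite [LHS]ffunE [kernelK_at _ _ _]ffunE.
    rewrite kernelK_diagonal scaler_sumr; apply: eq_bigr => y _.
    by rewrite -[LHS]/(_ * _) mulrCA [X in _ * X]mulrCA mulrA.
  rewrite exchange_big /= (bigD1 x) //= [X in _ + X]big1 => [|y yx]; last first.
    by rewrite -mulr_sumr walsh_orthogonal eq_sym (negPf yx) muln0 mulr0.
  rewrite addr0 -mulr_sumr walsh_orthogonal eqxx muln1 -[RHS]/(_ * _).
  by field; rewrite x0 pnatr_eq0 expn_eq0.
apply/memvZ/memv_suml => b _; apply/memvZ/memv_span/map_f.
by rewrite mem_enum.
Qed.

Lemma dim_HK : \dim (HK C n d) = #|[set x | kernel_eigenvalue x != 0]|.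
Proof.
rewrite HK_spectral.
set s := [seq x <- _ | _].
have us : uniq s by rewrite filter_uniq ?enum_uniq.
have /eqP -> := walsh_free us; rewrite size_map -(card_uniqP us).
by apply: eq_card => x; rewrite mem_filter mem_enum inE andbT.
Qed.

End Spectrum.

(** * Counting binary matrices by their column heights *)

Section Counting.
Local Open Scope nat_scope.

Definition height {n : nat} (v : 'cV['Z_2]_n) : nat :=
  \max_(i < n | v i ord0 != 0%R) i.+1.

Lemma height_leP {n : nat} (v : 'cV['Z_2]_n) (m : nat) :
  reflect (forall i : 'I_n, (m <= i)%N -> v i ord0 = 0%R) (height v <= m)%N.
Proof.
apply: (iffP (bigmax_leqP _ _ _)) => H i; last first.
  by rewrite ltnNge; apply: contra => /H ->.
by move=> mi; apply/eqP; apply: contraTT mi => /H; rewrite -ltnNge.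
Qed.

Lemma height_bound {n : nat} (v : 'cV['Z_2]_n) : (height v <= n)%N.
Proof. by apply/height_leP => i; rewrite leqNgt ltn_ord. Qed.

(** Below row [m] the entries are free, and from row [m] on they vanish. *)
Lemma card_height_le (n m : nat) : (m <= n)%N ->
  (\sum_(v : 'cV['Z_2]_n) (height v <= m) = 2 ^ m)%N.
Proof.
move=> mn.
transitivity (\prod_(p : 'I_n * 'I_1) \sum_(e : 'Z_2) ((p.1 < m) || (e == 0%R))).
  rewrite bigA_distr_matrix /=.
  apply: eq_bigr => v _; case E: (height v <= m)%N.
    move/height_leP: E => v0; rewrite big1 // => -[i j] _ /=; rewrite (ord1 j).
    by case: ltnP => // /v0 ->; rewrite eqxx.
  apply/esym/eqP; apply: contraFT E => P; apply/height_leP => i mi; apply/eqP.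
  apply: contraNT P => vi0.
  by rewrite (bigD1 (i, ord0)) //= ltnNge mi (negPf vi0).
transitivity (\prod_(p : 'I_n * 'I_1) (if p.1 < m then 2 else 1))%N.
  by apply: eq_bigr => p _; rewrite big_Z2; case: ltnP.
rewrite -(pair_bigA _ (fun (i : 'I_n) (j : 'I_1) => if i < m then 2 else 1)%N) /=.
under eq_bigr do rewrite big_ord1.
by rewrite -big_mkcond /= big_ord_narrow //= prod_nat_const card_ord.
Qed.

Definition total_height {n d : nat} (x : 'M['Z_2]_(n, d)) : nat :=
  \sum_(j < d) height (col j x).

Definition count_le (n d s : nat) : nat :=
  \sum_(x : 'M['Z_2]_(n, d)) (total_height x <= s).

(** The first column has height 0 in one way and height [m.+1] in [2 ^ m] ways.
    The condition [s <= n] ensures that every such height fits into [n] rows. *)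
Lemma count_le_recl (n d s : nat) : (s <= n)%N ->
  (count_le n d.+1 s = count_le n d s +
    \sum_(m < s) 2 ^ m * count_le n d (s - m.+1))%N.
Proof.
move=> sn.
transitivity (\sum_(v : 'cV['Z_2]_n) \sum_(x : 'M['Z_2]_(n, d))
    (height v + total_height x <= s))%N.
  rewrite pair_big /= /count_le -[d.+1]/(1 + d)%N.
  rewrite (reindex (fun p : 'cV['Z_2]_n * 'M['Z_2]_(n, d) => row_mx p.1 p.2)) /=.
    apply: eq_bigr => -[v x] _ /=; congr (nat_of_bool (_ <= _)%N).
    rewrite /total_height big_split_ord /= big_ord1 colKl col_id.
    by congr addn; apply: eq_bigr => j _; rewrite colKr.
  exists (fun x => (lsubmx x, rsubmx x)) => [[v x] _|x _] /=.
    by rewrite row_mxKl row_mxKr.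
  exact: hsubmxK.
transitivity (\sum_(v : 'cV['Z_2]_n | height v <= s) count_le n d (s - height v))%N.
  rewrite [RHS]big_mkcond; apply: eq_bigr => v _; case: leqP => vs.
    by apply: eq_bigr => x _; rewrite leq_subRL.
  by rewrite big1 // => x _; rewrite leqNgt ltn_addr.
(* The predecessor makes [2 ^ m.-1] equal to 1 both for m = 0 and for m = 1. *)
have cE m : (m <= n)%N -> \sum_(v : 'cV['Z_2]_n | height v == m) 1 = (2 ^ m.-1)%N.
  case: m => [|m] mn.
    rewrite -[RHS](card_height_le (leq0n n)) [LHS]big_mkcond; apply: eq_bigr => v _.
    by rewrite leqn0; case: eqP.
  apply/eqP; rewrite -(eqn_add2l (2 ^ m)) addnn -mul2n -expnS.
  rewrite -(card_height_le mn) -(card_height_le (ltnW mn)) [X in _ + X]big_mkcond.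
  rewrite -big_split; apply/eqP/eq_bigr => v _ /=.
  by rewrite [in RHS]leq_eqVlt ltnS; case: eqP => [->|]; rewrite ?ltnn ?addn0.
rewrite (partition_big (fun v => inord (height v) : 'I_s.+1) xpredT) //=.
have E (m : 'I_s.+1) : (\sum_(v : 'cV['Z_2]_n | (height v <= s) && (inord (height v) == m))
    count_le n d (s - height v) = 2 ^ m.-1 * count_le n d (s - m))%N.
  rewrite -(cE _ (leq_trans (leq_ord m) sn)) big_distrl /=.
  apply: eq_big => [v|v /andP[vs /eqP <-]]; last by rewrite inordK // mul1n.
  apply/andP/eqP => [[vs /eqP <-]|->]; first by rewrite inordK.
  by rewrite inord_val leq_ord.
rewrite (eq_bigr _ (fun m _ => E m)) big_ord_recl /= mul1n subn0.
by [].
Qed.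

Lemma sum_bin_hockey (i s : nat) : (\sum_(j < s) 'C(j, i) = 'C(s, i.+1))%N.
Proof.
by elim: s => [|s IH]; rewrite ?big_ord0 // big_ord_recr /= IH binS addnC.
Qed.

(** The recursion multiplies by [1 + S/2] the sequence s |-> count / 2^s, where [S]
    is summation over the earlier terms. Since [S] maps C(-, i) to
    C(-, i + 1), the coefficients of the powers of [1 + S/2] appear. *)
Lemma count_leE (n d s : nat) : (s <= n)%N ->
  count_le n d.+1 s = (\sum_(i < d.+1) 'C(d, i) * ('C(s, i) * 2 ^ (s - i)))%N.
Proof.
elim: d s => [|d IH] s sn; rewrite count_le_recl //.
  have c0 t : count_le n 0 t = 1%N.
    rewrite /count_le (eq_bigr (fun=> 1%N)) => [|x _]; last first.
      by rewrite /total_height big_ord0.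
    by rewrite sum_nat_const muln1 card_mx muln0.
  rewrite big_ord1 !bin0 c0 subn0 !mul1n.
  under eq_bigr do rewrite c0 muln1.
  elim: s {sn} => [|s IH]; first by rewrite big_ord0.
  by rewrite big_ord_recr /= addnA IH addnn -mul2n expnS.
rewrite IH // (eq_bigr (fun m : 'I_s => \sum_(i < d.+1)
    'C(d, i) * ('C(s - m.+1, i) * 2 ^ (s - i.+1)))%N); last first.
  move=> m _; rewrite IH ?(leq_trans (leq_subr _ _)) // big_distrr /=.
  apply: eq_bigr => i _; rewrite mulnCA; congr (_ * _)%N; rewrite mulnCA.
  (* Truncated subtraction breaks the exponent identity only where
     C(s - m - 1, i) = 0. *)
  have [lt|le] := ltnP (s - m.+1) i; first by rewrite bin_small.
  rewrite -expnD; congr (_ * 2 ^ _)%N. have := ltn_ord m; lia.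
rewrite exchange_big /=.
have -> : (\sum_(i < d.+1) \sum_(m < s) 'C(d, i) * ('C(s - m.+1, i) * 2 ^ (s - i.+1)) =
    \sum_(i < d.+1) 'C(d, i) * ('C(s, i.+1) * 2 ^ (s - i.+1)))%N.
  apply: eq_bigr => i _; rewrite -big_distrr -big_distrl /=; congr (_ * (_ * _))%N.
  rewrite -sum_bin_hockey (reindex_inj rev_ord_inj) /=; apply: eq_bigr => m _.
  by congr 'C(_, _); have := ltn_ord m; lia.
rewrite [RHS]big_ord_recl [X in (X + _)%N]big_ord_recl /= !bin0 -addnA; congr addn.
under [RHS]eq_bigr do rewrite binS mulnDl.
rewrite [RHS]big_split /=; congr addn.
by rewrite [RHS]big_ord_recr /= bin_small // mul0n addn0.
Qed.

End Counting.

(** * The dimension as a number of matrices *)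

Section Dimension.
Variables (C : numFieldType) (n d : nat).
Hypothesis d_gt0 : (0 < d)%N.

Lemma multinomial_weight_gt0 (l : {ffun 'I_d -> 'I_n.+1}) :
  0 < multinomial_weight C l.
Proof.
rewrite mulr_gt0 ?divr_gt0 ?invr_gt0 ?ltr0n ?expn_gt0 ?d_gt0 ?fact_gt0 //.
by rewrite prodn_gt0 // => j; rewrite fact_gt0.
Qed.

(** All terms of the eigenvalue are nonnegative, so it is nonzero iff one term
    is positive, that is, iff some [l] of sum [n] dominates the column heights. *)
Lemma kernel_eigenvalue_neq0 (x : dualZ2 n d) :
  (kernel_eigenvalue C x != 0) = (total_height x <= n)%N.
Proof.
pose wt (l : {ffun 'I_d -> 'I_n.+1}) : C := \prod_(p : 'I_n * 'I_d)
      (if (p.1 < l p.2)%N then 2^-1 else (x p.1 p.2 == 0)%:R).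
have wt_ge0 l : 0 <= wt l.
  by apply: prodr_ge0 => p _; case: ifP => _; rewrite ?invr_ge0 ler0n.
have wt_gt0 l : (0 < wt l) = [forall j, (height (col j x) <= l j)%N].
  rewrite lt0r wt_ge0 andbT; apply/idP/forallP => [/prodf_neq0 w0 j|hl].
    apply/height_leP => i li; apply/eqP; have := w0 (i, j) isT.
    by rewrite /= ltnNge li mxE pnatr_eq0 eqb0 negbK.
  apply/prodf_neq0 => -[i j] _ /=; case: ltnP => li; first by rewrite invr_neq0 ?pnatr_eq0.
  by have /height_leP/(_ i li) := hl j; rewrite mxE => ->; rewrite eqxx oner_neq0.
rewrite psumr_neq0 => [|l _]; last first.
  by apply: mulr_ge0; [exact/ltW/multinomial_weight_gt0|exact: wt_ge0].
apply/hasP/idP => [[l _ /andP[/eqP ln]]|xn].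
  rewrite pmulr_rgt0 ?multinomial_weight_gt0 // wt_gt0 => /forallP hl.
  by apply: leq_trans (leq_sum _ (fun j _ => hl j)) _; rewrite ln.
(* The slack is given to the first column, which exists since [0 < d]. *)
pose j0 := Ordinal d_gt0.
pose l : {ffun 'I_d -> 'I_n.+1} := [ffun j =>
  inord (height (col j x) + (if j == j0 then n - total_height x else 0))%N].
have lE j : l j = (height (col j x) + (if j == j0 then n - total_height x else 0))%N :> nat.
  rewrite ffunE inordK // ltnS; case: eqP => _; last by rewrite addn0 height_bound.
  by rewrite -[leqRHS](subnKC xn) leq_add2r /total_height (bigD1 j) //= leq_addr.
exists l; first by rewrite mem_index_enum.
rewrite pmulr_rgt0 ?multinomial_weight_gt0 // wt_gt0; apply/andP; split.
  rewrite (eq_bigr _ (fun j _ => lE j)) big_split /= -big_mkcond big_pred1_eq.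
  by rewrite -/(total_height x) subnKC.
by apply/forallP => j; rewrite lE leq_addr.
Qed.

Lemma dim_HK_count_le : \dim (HK C n d) = count_le n d n.
Proof.
rewrite dim_HK /count_le -sum1_card big_mkcond /=.
by apply: eq_bigr => x _; rewrite inE kernel_eigenvalue_neq0; case: leqP.
Qed.

End Dimension.

(** * Asymptotics *)

Section Asymptotics.
Variable R : realType.
Local Open Scope classical_set_scope.

Lemma cvg_inv_nat : (fun k : nat => k%:R^-1 : R) @ \oo --> (0 : R).
Proof.
by rewrite -(cvg_shiftS (fun k : nat => k%:R^-1 : R)); exact: cvg_harmonic.
Qed.

(** By induction from (i + 1) C(k, i + 1) = (k - i) C(k, i), since (k - i) / k tends
    to 1. *)
Lemma cvg_bin_pow (i : nat) :
  (fun k : nat => 'C(k, i)%:R / k%:R ^+ i : R) @ \oo --> (i`!%:R^-1 : R).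
Proof.
elim: i => [|i IH].
  have -> : 0`!%:R^-1 = 1 :> R by rewrite fact0 invr1.
  by apply: cvg_near_cst; apply: nearW => k; rewrite bin0 mulr1.
have lim : (fun k : nat => ('C(k, i)%:R / k%:R ^+ i) * (1 - i%:R * k%:R^-1) * i.+1%:R^-1 : R)
    @ \oo --> (i`!%:R^-1 * (1 - i%:R * 0) * i.+1%:R^-1 : R).
  apply: cvgMl; apply: cvgM => //; apply: cvgB; first exact: cvg_cst.
  by apply: cvgMr; exact: cvg_inv_nat.
have -> : i.+1`!%:R^-1 = i`!%:R^-1 * (1 - i%:R * 0) * i.+1%:R^-1 :> R.
  by rewrite factS natrM invfM mulr0 subr0 mulr1 mulrC.
apply: cvg_trans lim; apply: near_eq_cvg; near=> k.
have ik : (i < k)%N by near: k; exact: nbhs_infty_gt.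
have k0 : k%:R != 0 :> R by rewrite pnatr_eq0 -lt0n (leq_ltn_trans _ ik).
have i0 : i.+1%:R != 0 :> R by rewrite pnatr_eq0.
have E : i.+1%:R * 'C(k, i.+1)%:R = (k%:R - i%:R) * 'C(k, i)%:R :> R.
  by rewrite -natrB ?(ltnW ik) // -!natrM mul_bin_left.
have -> : 'C(k, i.+1)%:R = (k%:R - i%:R) * 'C(k, i)%:R / i.+1%:R :> R.
  by rewrite -E mulrAC divff ?mul1r.
by rewrite exprS; field; rewrite nat1r i0 k0 expf_neq0.
Unshelve. all: by end_near. Qed.

Lemma cvg_bin_pow0 (i d : nat) : (i < d)%N ->
  (fun k : nat => 'C(k, i)%:R / k%:R ^+ d : R) @ \oo --> (0 : R).
Proof.
move=> id.
have lim : (fun k : nat => 'C(k, i)%:R / k%:R ^+ i * (k%:R^-1) ^+ (d - i) : R) @ \oo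
    --> (i`!%:R^-1 * 0 ^+ (d - i) : R).
  apply: cvgM; first exact: cvg_bin_pow.
  exact: (cvg_comp _ _ cvg_inv_nat (@exprn_continuous R (d - i) 0)).
have z : i`!%:R^-1 * 0 ^+ (d - i) = 0 :> R by rewrite expr0n subn_eq0 leqNgt id mulr0.
rewrite z in lim.
apply: cvg_trans lim; apply: near_eq_cvg; near=> k.
have -> : k%:R ^+ d = k%:R ^+ i * k%:R ^+ (d - i) :> R.
  by rewrite -exprD subnKC // ltnW.
by rewrite invfM mulrA exprVn.
Unshelve. all: by end_near. Qed.

(** In the closed form only the summand of index [d] grows like [k ^ d]. *)
Lemma cvg_count_le (d : nat) :
  (fun k : nat => (count_le k d.+1 k)%:R / (2 ^+ k * k%:R ^+ d) : R) @ \oo -->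
  ((2 ^+ d * d`!%:R)^-1 : R).
Proof.
have lim : (fun k : nat => \sum_(i < d.+1)
      'C(d, i)%:R * 2^-1 ^+ i * ('C(k, i)%:R / k%:R ^+ d) : R) @ \oo -->
    (\sum_(i < d.+1) 'C(d, i)%:R * 2^-1 ^+ i * (if i == d :> nat then d`!%:R^-1 else 0) : R).
  apply: cvg_big => [|i _]; first exact: add_continuous.
  apply: cvgMr; case: eqP => [->|/eqP id]; first exact: cvg_bin_pow.
  by apply: cvg_bin_pow0; rewrite ltn_neqAle id -ltnS ltn_ord.
have -> : (2 ^+ d * d`!%:R)^-1 =
    \sum_(i < d.+1) 'C(d, i)%:R * 2^-1 ^+ i * (if i == d :> nat then d`!%:R^-1 else 0) :> R.
  rewrite big_ord_recr /= eqxx binn mul1r big1 ?add0r => [|i _].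
    by rewrite invfM exprVn.
  by rewrite ltn_eqF // mulr0.
apply: cvg_trans lim; apply: near_eq_cvg; near=> k.
rewrite count_leE // natr_sum mulr_suml; apply: eq_bigr => i _.
have [ki|ik] := ltnP k i; first by rewrite (bin_small ki) mul0n muln0 !mul0r mulr0.
rewrite !natrM natrX.
have -> : 2 ^+ k = 2 ^+ (k - i) * 2 ^+ i :> R by rewrite -exprD subnK.
rewrite exprVn.
have p0 j : 2 ^+ j != 0 :> R by rewrite expf_neq0 ?pnatr_eq0.
by rewrite invfM; move: (k%:R ^+ d)^-1 => K; field; rewrite !p0.
Unshelve. all: by end_near. Qed.

End Asymptotics.

Theorem theorem7 (R : realType) (d : nat) (hd : (1 <= d)%N) :
  asymp_equiv
    (fun k : nat => (\dim (HK R[i] k d))%:R : R)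
    (fun k : nat =>
       (2 : R) ^ (k%:Z - d%:Z + 1) * k%:R ^+ (d - 1) / ((d - 1)`!)%:R)
  /\
  asymp_equiv
    (fun k : nat => (\dim (HK R[i] k d))%:R / (2 : R) ^+ (k * d))
    (fun k : nat =>
       k%:R ^+ (d - 1)
         / ((2 : R) ^+ (d - 1) * ((d - 1)`!)%:R * (2 : R) ^+ (k * (d - 1)))).
Proof.
case: d hd => [//|d] _; rewrite !subSS !subn0.
have p0 j : 2 ^+ j != 0 :> R by rewrite expf_neq0 ?pnatr_eq0.
have f0 : d`!%:R != 0 :> R by rewrite pnatr_eq0 -lt0n fact_gt0.
have D0 : 2 ^+ d * d`!%:R != 0 :> R by rewrite mulf_neq0.
have lim : ((fun k : nat => (\dim (HK R[i] k d.+1))%:R / (2 ^+ k * k%:R ^+ d)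
    * (2 ^+ d * d`!%:R) : R) @ \oo -->
    ((2 ^+ d * d`!%:R)^-1 * (2 ^+ d * d`!%:R) : R))%classic.
  apply: cvgMl; under eq_cvg do rewrite dim_HK_count_le //.
  exact: cvg_count_le.
rewrite (mulVf D0) in lim.
split; rewrite /asymp_equiv; apply: cvg_trans lim; apply: near_eq_cvg; near=> k.
  have -> : k%:Z - d.+1%:Z + 1 = k%:Z - d%:Z by lia.
  rewrite expfzDr ?pnatr_eq0 // -exprnN -exprnP !invfM !invrK.
  (* Generalising the inverse covers k = 0, where [k ^ d] may vanish. *)
  by move: (k%:R ^+ d)^-1 => K; field; rewrite !p0.
rewrite mulnS exprD !invfM !invrK.
by move: (k%:R ^+ d)^-1 => K; field; rewrite !p0.
Unshelve. all: by end_near. Qed.
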